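(* Suppose that (1) the limit $f_\infty(1)=\lim_{n\to\infty}\frac{|s_1\cdots s_n|_1}{n}$ exists; (2) there is a strictly increasing sequence of positive integers $k_1<k_2<k_3<\cdots$ such that for every $n$ there exists a $k_n$-normal prefix of $S$ (so in particular the $k_n$-minimal prefix $p_{k_n}$ exists); (3) for every $\varepsilon>0$ there is a positive integer $L_\varepsilon$ such that for every $n$, every positive integer $m$ with $|b^n_m|>L_\varepsilon$, and every prefix $c^n_m$ of $b^n_m$ with $|c^n_m|\ge L_\varepsilon$, one has $|f_{b^n_m}(1)-f_{c^n_m}(1)|<\varepsilon$, where $b^n_m$ ($m=1,2,\dots$) are the blocks generated by the $k_n$-minimal prefix $p_{k_n}$. Then $f_\infty(1)=\frac12$.
   Context: Words are over the alphabet $\{1,2\}$; $|v|$ is the length of $v$ and $|v|_x$ the number of occurrences of the letter $x$ in $v$; for nonempty $v$, $f_v(x)=|v|_x/|v|$. For a finite or infinite word $v=a_1a_2\cdots$, its integral $v^{-1}$ is obtained by replacing each letter $a_i$ by $a_i$ copies of the letter $1$ if $i$ is odd and by $a_i$ copies of the letter $2$ if $i$ is even. Set $v^0=v$, $v^{-k}=(v^{-(k-1)})^{-1}$. The Kolakoski sequence $S=s_1s_2\cdots=1221121221\cdots$ is the unique infinite word over $\{1,2\}$ with $S^{-1}=S$; if $w$ is a prefix of $S$ then so is $w^{-k}$ for all $k\ge0$. A prefix $w$ of $S$ is $k$-regular if $|w^{-h}|$ is even for all $0\le h\le k$, and $k$-normal if it is $k$-regular but not $(k+1)$-regular. The $k$-minimal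 prefix is the shortest $k$-normal prefix of $S$ (if any exists). For a prefix $w$ of $S$ with $|w|>1$ and each positive integer $k$, the $k$-th block generated by $w$ is the unique word $b_k$ with $w^{-k+1}b_k=w^{-k}$; thus $S=wb_1b_2b_3\cdots$. *)

(* Defs.v *)
From mathcomp Require Import all_boot all_order all_algebra.
From mathcomp Require Import zify.
From mathcomp Require Import all_classical all_reals all_analysis.

Set Implicit Arguments.
Unset Strict Implicit.
Unset Printing Implicit Defensive.

(* Finite words are of type seq nat, infinite words of type nat -> nat, with
   letters 1 and 2.  Positions are 0-based, so the letter written s_i in
   1-based notation is s i.-1, and its prefix s_1 ... s_n is mkseq s n. *)
Definition is_letter (a : nat) : bool := a \in [:: 1; 2].

Definition other (x : nat) : nat := if x == 1 then 2 else 1.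

(* [integral_from x v] writes the runs whose lengths are the letters of v,
   alternating the letter written and starting with x. *)
Fixpoint integral_from (x : nat) (v : seq nat) : seq nat :=
  if v is a :: v' then nseq a x ++ integral_from (other x) v' else [::].

Definition word_integral (v : seq nat) : seq nat := integral_from 1 v.

(* v^{-k} *)
Definition iter_integral (k : nat) (v : seq nat) : seq nat :=
  iter k word_integral v.

(* Every letter contributes at least one letter to the integral, so the first
   i + 1 letters of s determine position i of its integral; the default value
   of nth is never used (see mkseq_integral_inf). *)
Definition integral_inf (s : nat -> nat) (i : nat) : nat :=
  nth 0 (word_integral (mkseq s i.+1)) i.

Definition is_kolakoski (s : nat -> nat) : Prop :=
  (forall i, is_letter (s i)) /\ (forall i, integral_inf s i = s i).

Definition prefix_of (s : nat -> nat) (w : seq nat) : Prop :=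
  w = mkseq s (size w).

Definition kregular (s : nat -> nat) (k : nat) (w : seq nat) : Prop :=
  prefix_of s w /\ forall h, h <= k -> ~~ odd (size (iter_integral h w)).

Definition knormal (s : nat -> nat) (k : nat) (w : seq nat) : Prop :=
  kregular s k w /\ ~ kregular s k.+1 w.

Definition kminimal (s : nat -> nat) (k : nat) (p : seq nat) : Prop :=
  knormal s k p /\ forall w, knormal s k w -> size p <= size w.

(* b is the k-th block generated by w, for k > 0. *)
Definition is_block (w : seq nat) (k : nat) (b : seq nat) : Prop :=
  iter_integral k.-1 w ++ b = iter_integral k w.

Definition freq (R : realType) (x : nat) (v : seq nat) : R :=
  ((count_mem x v)%:R / (size v)%:R)%R.

Definition prefix_freq (R : realType) (s : nat -> nat) (x n : nat) : R :=
  freq R x (mkseq s n).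

Lemma integral_from_cat x u v :
  integral_from x (u ++ v) =
  integral_from x u ++ integral_from (iter (size u) other x) v.
Proof.
by elim: u x => [|a u IH] x //=; rewrite IH catA -iterS iterSr.
Qed.

Lemma size_integral_from x v : size (integral_from x v) = sumn v.
Proof. by elim: v x => [|a v IH] x //=; rewrite size_cat size_nseq IH. Qed.

Lemma prefix_integral u v :
  prefix u v -> prefix (word_integral u) (word_integral v).
Proof.
by move=> /prefixP[t ->]; rewrite /word_integral integral_from_cat
  prefix_prefix.
Qed.

Lemma all_letter_integral v : all is_letter (word_integral v).
Proof.
suff H x : is_letter x -> all is_letter (integral_from x v) by exact: H.
elim: v x => [|a v IH] x lx //=; rewrite all_cat all_nseq lx orbT /=.
by apply: IH; rewrite /other; case: ifP.
Qed.

Lemma size_integral_ge v : all is_letter v -> size v <= size (word_integral v).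
Proof.
rewrite /word_integral size_integral_from; elim: v => //= a v IH /andP[la lv].
by have := IH lv; move: la; rewrite /is_letter !inE; lia.
Qed.

Lemma size_integral_gt v :
  all is_letter v -> 2 \in v -> size v < size (word_integral v).
Proof.
rewrite /word_integral size_integral_from; elim: v => //= a v IH /andP[la lv].
have := size_integral_ge lv; rewrite /word_integral size_integral_from => h.
rewrite inE => /orP[/eqP <-|/(IH lv)]; first by lia.
by move: la; rewrite /is_letter !inE; lia.
Qed.

Lemma nth_prefix u v i : prefix u v -> i < size u -> nth 0 u i = nth 0 v i.
Proof. by move=> /prefixP[t ->] lt; rewrite nth_cat lt. Qed.

Lemma prefix_mkseq (s : nat -> nat) m n :
  m <= n -> prefix (mkseq s m) (mkseq s n).
Proof.
move=> le; apply/prefixP; exists [seq s i | i <- iota m (n - m)].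
by rewrite /mkseq -map_cat -{2}[m]add0n -iotaD subnKC.
Qed.

Lemma all_letter_mkseq s n : (forall i, is_letter (s i)) ->
  all is_letter (mkseq s n).
Proof. by move=> h; apply/allP => x /mapP[i _ ->]. Qed.

(* The integral of an infinite word is the limit of those of its prefixes. *)
Lemma mkseq_integral_inf s n : (forall i, is_letter (s i)) ->
  prefix_of (integral_inf s) (word_integral (mkseq s n)).
Proof.
move=> ls; apply: (@eq_from_nth _ 0); rewrite ?size_mkseq // => i lti.
rewrite nth_mkseq // /integral_inf.
have li : i < size (word_integral (mkseq s i.+1)).
  apply: leq_trans (size_integral_ge (all_letter_mkseq _ ls)).
  by rewrite size_mkseq.
case: (leqP n i.+1) => h.
  by apply: nth_prefix => //; apply/prefix_integral/prefix_mkseq.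
by apply/esym/nth_prefix => //; apply/prefix_integral/prefix_mkseq/ltnW.
Qed.

Lemma kolakoski_exists : exists s, is_kolakoski s.
Proof.
pose w j := iter_integral j [:: 1; 2].
have wS j : prefix (w j) (w j.+1).
  by elim: j => // j IH; apply: prefix_integral.
have wle i j : i <= j -> prefix (w i) (w j).
  move=> /subnK <-; elim: (j - i) => [|d IH]; first exact: prefix_refl.
  exact: prefix_trans IH (wS _).
have lw j : all is_letter (w j) by case: j => // j; apply: all_letter_integral.
have szw j : j < size (w j).
  elim: j => // j IH; apply: leq_ltn_trans IH (size_integral_gt (lw j) _).
  by have /prefixP[t ->] := wle _ _ (leq0n j); rewrite !inE.
pose s i := nth 0 (w i) i.
have ls i : is_letter (s i) by exact: (allP (lw i)) (mem_nth _ (szw i)).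
exists s; split=> // i.
have ps : prefix (mkseq s i.+1) (w i).
  apply/prefixP; exists (drop i.+1 (w i)).
  suff -> : mkseq s i.+1 = take i.+1 (w i) by rewrite cat_take_drop.
  have sz : size (take i.+1 (w i)) = i.+1 by rewrite size_takel.
  apply: (@eq_from_nth _ 0); rewrite size_mkseq ?sz // => j lj.
  rewrite nth_mkseq // nth_take //; apply: nth_prefix (szw j).
  exact: wle.
rewrite /integral_inf (nth_prefix (prefix_integral ps)).
  by apply/esym/(nth_prefix (wS i))/szw.
apply: leq_trans (size_integral_ge (all_letter_mkseq _ ls)).
by rewrite size_mkseq.
Qed.

Lemma kolakoski_unique s t : is_kolakoski s -> is_kolakoski t -> s =1 t.
Proof.
have s0 u : is_kolakoski u -> u 0 = 1.
  case=> lu eu; rewrite -eu /integral_inf /word_integral /mkseq /=.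
  by have := lu 0; rewrite /is_letter !inE => /orP[] /eqP ->.
have s1 u : is_kolakoski u -> u 1 = 2.
  move=> ku; have := s0 _ ku; case: ku => lu eu u0.
  rewrite -eu /integral_inf /word_integral /mkseq /= u0 /=.
  by have := lu 1; rewrite /is_letter !inE => /orP[] /eqP ->.
have step u i : is_kolakoski u -> 1 < i ->
    u i = nth 0 (word_integral (mkseq u i)) i.
  move=> ku gt1; have := ku => -[lu eu]; rewrite -{1}eu /integral_inf.
  apply/esym/nth_prefix; first by apply/prefix_integral/prefix_mkseq/leqnSn.
  rewrite -{1}(size_mkseq u i); apply: size_integral_gt.
    exact: all_letter_mkseq.
  by apply/mapP; exists 1; rewrite ?s1 // mem_iota.
move=> ks kt i; elim/ltn_ind: i => -[|[|i]] IH; rewrite ?s0 ?s1 //.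
rewrite (step s) // (step t) //; congr (nth _ (word_integral _) _).
apply/eq_in_map => j; rewrite mem_iota => /andP[_]; rewrite add0n.
exact: IH.
Qed.

(* Main.v *)
Require Import Defs.
From HB Require Import structures.
From mathcomp Require Import all_boot all_order all_algebra.
From mathcomp Require Import zify lra.
From mathcomp Require Import all_classical all_reals all_analysis.

(** Let [p] be the [k]-minimal prefix, [k = k_n]. Since [|p^{-h}|] is even for
    [h <= k] and odd for [h = k + 1], the blocks [b_1, ..., b_{k+2}] are the
    iterated integrals of [b_1], but [b_{k+3}] is the integral of [b_{k+2}]
    with the two letters exchanged. The second integral of any word with at
    least two letters starts with [12], so [b_{k+3}] starts with the complement
    [c] of [12^{-k}], a prefix of [S] with more than [k] letters, and for large
    [k] the frequency of [1] in [c] is close to [1 - f_oo(1)]. On the other hand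
    [b_{k+3}] is the difference of two prefixes of [S] and makes up a positive
    proportion of them, so its frequency of [1] is close to [f_oo(1)].
    Hypothesis (3) says that the two frequencies are close to each other. *)

Import Order.TTheory GRing.Theory Num.Theory.
Import numFieldNormedType.Exports.

(** * Exchange of the letters, and letter counts of integrals *)

Lemma otherK {x} : is_letter x -> other (other x) = x.
Proof. by rewrite /is_letter !inE => /orP[]/eqP->. Qed.

Lemma is_letter_other x : is_letter (other x).
Proof. by rewrite /other; case: ifP. Qed.

Lemma iter_other_1 n : iter n other 1 = if odd n then 2 else 1.
Proof. by elim: n => //= n ->; case: (odd n). Qed.

Lemma integral_from_other {x v} : is_letter x ->
  integral_from (other x) v = map other (integral_from x v).
Proof.
elim: v x => [|a v IH] x lx //=.
by rewrite IH ?is_letter_other // map_cat map_nseq.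
Qed.

(** Runs have length 1 or 2 and alternate. Each run of [other x] follows a run of [x]; each run of
    [x], except possibly the last, precedes a run of [other x], whence the [+ 2]. *)
Lemma count_integral_from {x v} : is_letter x -> all is_letter v ->
  count_mem x (integral_from x v) <=
    2 * count_mem (other x) (integral_from x v) + 2 /\
  count_mem (other x) (integral_from x v) <=
    2 * count_mem x (integral_from x v).
Proof.
elim: v x => [|a v IH] x lx //= /andP[la lv].
have := IH _ (is_letter_other x) lv; rewrite otherK // !count_cat !count_nseq /=.
have -> : (x == other x) = false.
  by move: lx; rewrite /is_letter !inE => /orP[]/eqP->.
by rewrite eqxx; move: la; rewrite /is_letter !inE; lia.
Qed.

Lemma sumn_letters {v} : all is_letter v -> sumn v = size v + count_mem 2 v.
Proof.
elim: v => //= a v IH /andP[la /IH ->].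
by move: la; rewrite /is_letter !inE => /orP[]/eqP->/=; lia.
Qed.

Lemma count_letters {v} : all is_letter v ->
  count_mem 1 v + count_mem 2 v = size v.
Proof.
elim: v => //= a v IH /andP[la /IH <-].
by move: la; rewrite /is_letter !inE => /orP[]/eqP->/=; lia.
Qed.

Lemma count1_map_other {v} : all is_letter v ->
  count_mem 1 (map other v) = count_mem 2 v.
Proof.
move=> /allP lv; rewrite count_map; apply: eq_in_count => x /lv.
by rewrite /is_letter !inE => /orP[]/eqP->.
Qed.

Lemma all_letter_iter_integral h {v} : all is_letter v ->
  all is_letter (iter_integral h v).
Proof. by case: h => // h _; apply: all_letter_integral. Qed.

Lemma size_word_integral_count2 {v} : all is_letter v ->
  size (word_integral v) = size v + count_mem 2 v.
Proof.
by move=> lv; rewrite /word_integral size_integral_from sumn_letters.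
Qed.

Lemma size_word_integral_le {v} : all is_letter v ->
  size (word_integral v) <= 3 * count_mem 2 (word_integral v) + 2.
Proof.
move=> lv; rewrite -(count_letters (all_letter_integral v)).
have [+ _] := count_integral_from (x := 1) isT lv.
by rewrite -/(word_integral v) -[other 1]/2; lia.
Qed.

Lemma prefix_iter_integral h {u v} : prefix u v ->
  prefix (iter_integral h u) (iter_integral h v).
Proof. by move=> uv; elim: h => //= h; apply: prefix_integral. Qed.

(** The first integral starts with 1 and has a second letter, so in the second integral a single 1
    is followed by 2. *)
Lemma prefix_12_iter_integral2 {v} : all is_letter v -> 1 < size v ->
  prefix [:: 1; 2] (iter_integral 2 v).
Proof.
case: v => [|a [|b v]] //= /and3P[la lb _] _.
move: la lb; rewrite /is_letter !inE => /orP[]/eqP-> /orP[]/eqP-> //=.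
Qed.

(** Each iterate starts with 12, and its letter 2 makes the next one strictly longer. *)
Lemma size_iter_integral_12 h : h < size (iter_integral h [:: 1; 2]).
Proof.
elim: h => // h IH; apply: leq_ltn_trans IH (size_integral_gt _ _).
  exact: all_letter_iter_integral.
have /prefixP[t ->] : prefix [:: 1; 2] (iter_integral h [:: 1; 2]).
  by elim: h => // h IH; apply: prefix_trans (prefix_integral IH).
by rewrite !inE.
Qed.

(** * Prefixes of the Kolakoski sequence and their integrals *)

Lemma kolakoski_0 {S} : is_kolakoski S -> S 0 = 1.
Proof.
case=> lS eS; rewrite -eS /integral_inf /word_integral /=.
by have := lS 0; rewrite /is_letter !inE => /orP[] /eqP ->.
Qed.

Lemma kolakoski_1 {S} : is_kolakoski S -> S 1 = 2.
Proof.
move=> kS; have S0 := kolakoski_0 kS; case: kS => lS eS.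
rewrite -eS /integral_inf /word_integral /= S0 /=.
by have := lS 1; rewrite /is_letter !inE => /orP[] /eqP ->.
Qed.

Lemma prefix_of_integral {S w} : is_kolakoski S -> prefix_of S w ->
  prefix_of S (word_integral w).
Proof.
move=> [lS eS] ->; rewrite /prefix_of {1}mkseq_integral_inf //.
exact: eq_mkseq.
Qed.

Lemma prefix_of_iter_integral {S} h {w} : is_kolakoski S -> prefix_of S w ->
  prefix_of S (iter_integral h w).
Proof. by move=> kS pw; elim: h => //= h; apply: prefix_of_integral. Qed.

Lemma prefix_of_prefix {S u v} : prefix_of S u -> prefix_of S v ->
  size u <= size v -> prefix u v.
Proof. by move=> -> ->; rewrite !size_mkseq; apply: prefix_mkseq. Qed.

Lemma prefix_of_letters {S w} : is_kolakoski S -> prefix_of S w ->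
  all is_letter w.
Proof. by move=> [lS _] ->; apply: all_letter_mkseq. Qed.

Lemma prefix_of_12 {S} : is_kolakoski S -> prefix_of S [:: 1; 2].
Proof.
by move=> kS; rewrite /prefix_of /= /mkseq /= kolakoski_0 ?kolakoski_1.
Qed.

(** * Normal prefixes and the block after the change of parity *)

Lemma kminimal_exists {S k} : (exists w, knormal S k w) ->
  exists p, kminimal S k p.
Proof.
move=> [w kw].
have ex : exists n, `[< exists2 w, knormal S k w & size w = n >].
  by exists (size w); apply/asboolP; exists w.
have [_ /asboolP[p kp <-] min] := ex_minnP ex.
by exists p; split=> // v kv; apply: min; apply/asboolP; exists v.
Qed.

Lemma knormal_odd {S k p} : knormal S k p ->
  odd (size (iter_integral k.+1 p)).
Proof.
move=> [[pS reg] nreg]; apply/negP => /negP ev; apply: nreg; split=> // h.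
by rewrite leq_eqVlt => /orP[/eqP->//|]; apply: reg.
Qed.

(** Parity rules out length 1, the empty word has only empty integrals, and 12 has the integral 122
    of odd length. *)
Lemma knormal_size {S k p} : is_kolakoski S -> 0 < k -> knormal S k p ->
  3 <= size p.
Proof.
move=> kS k0 kp; have odd_p := knormal_odd kp.
have [[pS reg] _] := kp; case: ltnP => // le2.
have /(reg 1) := k0; have /(reg 0) := leq0n k; rewrite /=.
case E: (size p) => [|[|[|n]]] //; last by lia.
  have nilp : p = [::] by apply: size0nil.
  have nilk j : iter_integral j [::] = [::] by elim: j => //= j ->.
  by move: odd_p; rewrite nilp nilk.
suff -> : p = [:: 1; 2] by [].
by rewrite pS (prefix_of_12 kS) E.
Qed.

Lemma knormal_block {S k p} : is_kolakoski S -> 0 < k -> knormal S k p ->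
  exists2 b, is_block p k.+3 b &
    prefix (map other (iter_integral k [:: 1; 2])) b.
Proof.
move=> kS k0 kp; have [[pS reg] _] := kp.
have lp := prefix_of_letters kS pS.
have /prefixP[b1 eb1] : prefix p (word_integral p).
  apply: (prefix_of_prefix (S := S)) => //; first exact: prefix_of_integral.
  exact: size_integral_ge.
have lb1 : all is_letter b1.
  by have := all_letter_integral p; rewrite eb1 all_cat => /andP[].
(* [size b1] is the number of 2s in [p], and [p] starts with 122. *)
have sb1 : 1 < size b1.
  have := size_word_integral_count2 lp; rewrite eb1 size_cat => /addnI ->.
  have /prefixP[t ->] : prefix [:: 1; 2; 2] p.
    apply: (prefix_of_prefix (S := S)) => //; last exact: knormal_size kp.
    exact: (prefix_of_integral kS (prefix_of_12 kS)).
  by rewrite /=; lia.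
(* After a word of even length the integral resumes with the letter 1. *)
have step h : h <= k.+1 ->
    iter_integral h p ++ iter_integral h b1 = iter_integral h.+1 p.
  elim: h => // h IH lt; rewrite -[RHS]/(word_integral (iter_integral h.+1 p)).
  rewrite -[in RHS]IH ?(ltnW lt) // [RHS]integral_from_cat iter_other_1.
  by rewrite (negbTE (reg h lt)).
(* [iter_integral k.+1 p] has odd length, so the integral resumes with 2. *)
exists (integral_from 2 (iter_integral k.+1 b1)).
  rewrite /is_block -[RHS]/(word_integral (iter_integral k.+2 p)).
  rewrite -[in RHS]step // [RHS]integral_from_cat iter_other_1.
  by rewrite (knormal_odd kp).
rewrite -[2]/(other 1) integral_from_other //.
rewrite -[integral_from 1 _]/(iter_integral k.+2 b1).
have -> : iter_integral k.+2 b1 = iter_integral k (iter_integral 2 b1).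
  by rewrite /iter_integral -iterD addn2.
have := prefix_iter_integral k (prefix_12_iter_integral2 lb1 sb1).
by move=> /prefixP[t ->]; rewrite map_cat prefix_prefix.
Qed.

(** * Frequencies of letters and the limit *)

Local Open Scope ring_scope.

Lemma freq_map_other {R : realType} {v} : all is_letter v -> (0 < size v)%N ->
  freq R 1 (map other v) = 1 - freq R 1 v.
Proof.
move=> lv v0; rewrite /freq size_map count1_map_other //.
have v0' : (size v)%:R != 0 :> R by rewrite pnatr_eq0 -lt0n.
apply: (mulIf v0'); rewrite mulrBl mul1r !divfK //.
by rewrite -(count_letters lv) natrD addrC addKr.
Qed.

Lemma freq_dist_lt {R : realType} {x v} {d e : R} : (0 < size v)%N ->
  (`|freq R x v - d| < e) =
  (`|(count_mem x v)%:R - d * (size v)%:R| < e * (size v)%:R).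
Proof.
move=> v0; have v0' : 0 < (size v)%:R :> R by rewrite ltr0n.
rewrite /freq -(ltr_pM2r v0') -{2}(gtr0_norm v0') -normrM mulrBl.
by rewrite divfK // gt_eqF.
Qed.

(** Subtracting counts, [v] deviates from [d * size v] by less than [e * (2 * size u + size v)]. *)
Lemma freq_suffix {R : realType} {x} u {v} {d e : R} {K : nat} :
  (0 < size u)%N -> (0 < size v)%N -> (size u <= K * size v)%N -> 0 < e ->
  `|freq R x u - d| < e -> `|freq R x (u ++ v) - d| < e ->
  `|freq R x v - d| < (2 * K%:R + 1) * e.
Proof.
move=> u0 v0 le e0; rewrite !freq_dist_lt // ?size_cat ?addn_gt0 ?u0 //.
rewrite count_cat !natrD !ltr_norml => /andP[h1 h2] /andP[h3 h4].
have : (size u)%:R * e <= K%:R * (size v)%:R * e.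
  by rewrite ler_pM2r // -natrM ler_nat.
by move=> h5; apply/andP; split; nra.
Qed.

Theorem theorem5 (R : realType) (S : nat -> nat) (hS : is_kolakoski S)
  (hlim : cvgn (prefix_freq R S 1))
  (k : nat -> nat)
  (kpos : forall n : nat, (0 < k n)%N)
  (kincr : forall i j : nat, (i < j)%N -> (k i < k j)%N)
  (hnormal : forall n : nat, exists w : seq nat, knormal S (k n) w)
  (hblocks : forall eps : R, 0 < eps ->
    exists2 L : nat, (0 < L)%N &
      forall (n : nat) (p : seq nat), kminimal S (k n) p ->
      forall (m : nat) (b : seq nat), (0 < m)%N -> is_block p m b ->
        (L < size b)%N ->
      forall c : seq nat, prefix c b -> (L <= size c)%N ->
        `|freq R 1 b - freq R 1 c| < eps) :
  limn (prefix_freq R S 1) = 2^-1.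
Proof.
set d := limn _.
(* 13 = 11 + 1 + 1: the errors of [freq_b], of [freq_w] and of hypothesis (3). *)
have dist_le e : 0 < e -> `|d - (1 - d)| <= 13 * e.
  move=> e0.
  have [N _ freqN] : \forall n \near \oo%classic, `|prefix_freq R S 1 n - d| < e.
    by have /cvgrPdistC_lt := hlim; apply.
  have freqS w : prefix_of S w -> (N <= size w)%N -> `|freq R 1 w - d| < e.
    by move=> -> le; apply: freqN; rewrite size_mkseq in le.
  have [L _ hL] := hblocks e e0.
  (* As [n <= k n], words with more than [k n] letters are long enough for both [L] and [N]. *)
  pose n := maxn L N.
  have le_k i : (i <= k i)%N.
    by elim: i => // i IH; apply: leq_ltn_trans IH (kincr _ _ _).
  have le_n : (n <= k n)%N by [].
  have [p minp] := kminimal_exists (hnormal n).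
  have kp := minp.1; have [[pS _] _] := kp.
  have lp := prefix_of_letters hS pS.
  have [b blockb] := knormal_block hS (kpos n) kp.
  set K := k n in le_n kp blockb *; set w := iter_integral K _ => prefb.
  have K_lt_w : (K < size w)%N by apply: size_iter_integral_12.
  have size_wb : (size w <= size b)%N.
    by have := size_prefix prefb; rewrite size_map.
  have pS12 := prefix_of_12 hS.
  set u := iter_integral K.+2 p.
  have K_lt_u : (K < size u)%N.
    have : prefix [:: 1; 2] p.
      apply: prefix_of_prefix pS12 pS _.
      exact: ltnW (knormal_size hS (kpos n) kp).
    move=> /(prefix_iter_integral K.+2)/size_prefix; apply: leq_trans.
    by apply: leq_trans (size_iter_integral_12 _); lia.
  have eq_ub : u ++ b = word_integral u by [].
  have lu : all is_letter u by apply: all_letter_iter_integral.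
  (* [size b] is the number of 2s in [u]. As [u] is itself an integral, [size u <= 3 * size b + 2],
     and [b] is nonempty. *)
  have size_u : (size u <= 5 * size b)%N.
    have := size_word_integral_count2 lu; rewrite -eq_ub size_cat => /addnI eb.
    have := size_word_integral_le (all_letter_iter_integral K.+1 lp).
    rewrite -[word_integral _]/u -eb; lia.
  have freq_b : `|freq R 1 b - d| < (2 * 5%:R + 1) * e.
    apply: (freq_suffix u) => //; try lia.
      by apply: freqS; [exact: prefix_of_iter_integral|lia].
    rewrite eq_ub -[word_integral u]/(iter_integral K.+3 p).
    apply: freqS; first exact: prefix_of_iter_integral.
    rewrite -[iter_integral _ _]/(word_integral u) -eq_ub size_cat; lia.
  have freq_w : `|freq R 1 w - d| < e.
    by apply: freqS; [exact: prefix_of_iter_integral|lia].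
  (* The prefix of [b] used here is [map other w], where 1 has frequency [1 - freq R 1 w]. *)
  have := hL n p minp K.+3 b isT blockb _ _ prefb.
  rewrite size_map freq_map_other; [|exact: all_letter_iter_integral|lia].
  move=> /(_ ltac:(lia) ltac:(lia)).
  move: freq_b freq_w; rewrite !ltr_norml ler_norml.
  by move=> /andP[? ?] /andP[? ?] /andP[? ?]; apply/andP; split; lra.
have /eqP : `|d - (1 - d)| = 0.
  apply/eqP; rewrite eq_le normr_ge0 andbT; apply/ler_addgt0Pr => e e0.
  by rewrite add0r (le_trans (dist_le (e / 13) _)) //; lra.
rewrite normr_eq0 => /eqP; lra.
Qed.
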